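(* For integers $n\ge 2$ let $$I(n,n)=\int_{[0,\pi/2]^{n-1}}\big(x_1+\cdots+x_n\big)^n\,d\phi_1\cdots d\phi_{n-1},$$ where $(x_1,\ldots,x_n)$ is the point of the Euclidean unit sphere of $\mathbb{R}^n$ with hyperspherical coordinates $(\phi_1,\ldots,\phi_{n-1})$, and for $\rho>0$ let $$\overline{\mathrm{Vol}}_n(\rho)=\frac{\rho^n2^n}{n!\,(\pi/2)^{n-1}}\,I(n,n).$$ Then $$\lim_{n\to\infty}\frac{I(n,n)\,2^n/\big(n!\,(\pi/2)^{n-1}\big)}{\pi^{n/2}/\Gamma(n/2+1)}=0.$$ Consequently, there is an integer $n_0$ such that for all $n\ge n_0$ and all $\rho>0$ one has $\overline{\mathrm{Vol}}_n(\rho)<\mathrm{Vol}(B_{Euclid}(\rho))$, where $B_{Euclid}(\rho)$ is the Euclidean ball of radius $\rho$ in $\mathbb{R}^n$.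
   Context: Hyperspherical coordinates on the part of the unit sphere with nonnegative coordinates are given by angles $\phi_1,\ldots,\phi_{n-1}\in[0,\pi/2]$ via $$x_1=\cos\phi_1,\quad x_j=\sin\phi_1\cdots\sin\phi_{j-1}\cos\phi_j\ (2\le j\le n-1),\quad x_n=\sin\phi_1\cdots\sin\phi_{n-1}.$$ The Lee ($l_1$) ball of radius $s$ in $\mathbb{R}^n$ has volume $2^ns^n/n!$, so $\overline{\mathrm{Vol}}_n(\rho)$ is the average, over $(\phi_1,\ldots,\phi_{n-1})$ uniformly distributed in $[0,\pi/2]^{n-1}$ (plain Lebesgue measure in the angles), of the volume of the $l_1$ ball centered at the origin whose boundary passes through the point $\rho\,(x_1,\ldots,x_n)$ of the Euclidean sphere of radius $\rho$. $\Gamma$ is the Gamma function, and $\pi^{n/2}/\Gamma(n/2+1)$ is the volume of the Euclidean unit ball of $\mathbb{R}^n$. *)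

(* Defs.v *)
From HB Require Import structures.
From mathcomp Require Import all_boot all_order all_algebra.
From mathcomp Require Import all_classical all_reals all_analysis.

Set Implicit Arguments.
Unset Strict Implicit.
Unset Printing Implicit Defensive.

Import Order.TTheory GRing.Theory Num.Theory.
Import numFieldNormedType.Exports.

Local Open Scope classical_set_scope.
Local Open Scope ring_scope.

Section cons_tuple.
Context d (T : measurableType d) (n : nat).

Definition cons_tuple (xt : T * n.-tuple T) : n.+1.-tuple T :=
  [tuple of xt.1 :: xt.2].

Definition uncons_tuple (t : n.+1.-tuple T) : T * n.-tuple T :=
  (thead t, [tuple of behead t]).

Lemma cons_tupleK : cancel cons_tuple uncons_tuple.
Proof. by case=> x t; congr pair; exact/val_inj. Qed.

Lemma measurable_cons_tuple : measurable_fun [set: T * n.-tuple T] cons_tuple.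
Proof. by apply: measurable_cons. Qed.

Lemma measurable_uncons_tuple :
  measurable_fun [set: n.+1.-tuple T] uncons_tuple.
Proof.
apply/measurable_fun_pairP; split; last exact: measurable_behead.
exact: measurable_tnth.
Qed.

End cons_tuple.

Section cons_measure.
Local Open Scope ereal_scope.
Context d (T : measurableType d) (R : realType) (n : nat).
Variable mu : {sigma_finite_measure set T -> \bar R}.
Variable nu : {sigma_finite_measure set (n.-tuple T) -> \bar R}.

Definition cons_measure : set (n.+1.-tuple T) -> \bar R :=
  pushforward (mu \x nu) (@cons_tuple _ T n).

Let measurable_preimage_cons A : measurable A ->
  measurable (@cons_tuple _ T n @^-1` A).
Proof.
by move=> mA; rewrite -[X in measurable X]setTI; exact: measurable_cons_tuple.
Qed.

Let cons_measure0 : cons_measure set0 = 0.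
Proof. by rewrite /cons_measure /pushforward preimage_set0 measure0. Qed.

Let cons_measure_ge0 A : 0 <= cons_measure A.
Proof. by rewrite /cons_measure /pushforward measure_ge0. Qed.

Let cons_measure_sigma_additive : semi_sigma_additive cons_measure.
Proof.
move=> F mF tF mUF; rewrite /cons_measure /pushforward preimage_bigcup.
apply: measure_semi_sigma_additive.
- by move=> k; exact: measurable_preimage_cons.
- apply/trivIsetP => /= i j _ _ ij; rewrite -preimage_setI.
  by move/trivIsetP : tF => /(_ _ _ _ _ ij) ->//; rewrite preimage_set0.
- by rewrite -preimage_bigcup; exact: measurable_preimage_cons.
Qed.

HB.instance Definition _ := isMeasure.Build _ _ _ cons_measure
  cons_measure0 cons_measure_ge0 cons_measure_sigma_additive.

Let cons_measure_sigma_finite : sigma_finite setT cons_measure.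
Proof.
have /sigma_finiteP[F [TF ndF Foo]] := sigma_finiteT mu.
have /sigma_finiteP[G [TG ndG Goo]] := sigma_finiteT nu.
exists (fun k => @uncons_tuple _ T n @^-1` (F k `*` G k)).
  rewrite -preimage_bigcup -(preimage_setT (@uncons_tuple _ T n)).
  congr (_ @^-1` _); apply/esym; rewrite -subTset => -[x t] _.
  have [i _ Fix] : (\bigcup_i F i) x by rewrite -TF.
  have [j _ Gjt] : (\bigcup_i G i) t by rewrite -TG.
  exists (maxn i j) => //; split => /=.
    by move: x Fix; exact/subsetPset/ndF/leq_maxl.
  by move: t Gjt; exact/subsetPset/ndG/leq_maxr.
move=> k; have [? ?] := Foo k; have [? ?] := Goo k; split.
  rewrite -[X in measurable X]setTI; apply: measurable_uncons_tuple => //.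
  exact: measurableX.
rewrite /cons_measure /pushforward -comp_preimage.
rewrite (_ : _ \o _ = id); last by apply/funext => x; exact: cons_tupleK.
by rewrite preimage_id product_measure1E// lte_mul_pinfty// ge0_fin_numE.
Qed.

HB.instance Definition _ := Measure_isSigmaFinite.Build _ _ _ cons_measure
  cons_measure_sigma_finite.

End cons_measure.

Section lebesgue_tuple.
Context (R : realType).
Local Open Scope ereal_scope.

(* Lebesgue measure on R^n, as the n-fold product of the one on R; see
   lebesgue_tuple_box for its value on boxes. *)
Fixpoint lebesgue_tuple (n : nat) :
    {sigma_finite_measure set (n.-tuple (measurableTypeR R)) -> \bar R} :=
  match n with
  | 0%N => \d_([tuple] : 0.-tuple (measurableTypeR R))
  | m.+1 => cons_measure lebesgue_measure (lebesgue_tuple m)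
  end.

Lemma measurable_tuple_box n (A : 'I_n -> set (measurableTypeR R)) :
  (forall i, measurable (A i)) ->
  measurable [set t : n.-tuple (measurableTypeR R) | forall i, A i (tnth t i)].
Proof.
move=> mA.
rewrite (_ : [set t | _] = \bigcap_(i in [set: 'I_n])
    ((fun t : n.-tuple (measurableTypeR R) => tnth t i) @^-1` A i)).
  apply: fin_bigcap_measurable => // i _.
  by rewrite -[X in measurable X]setTI; exact: measurable_tnth.
by apply/seteqP; split => [t At i _|t At i]; exact: At.
Qed.

Lemma lebesgue_tuple_box n (A : 'I_n -> set (measurableTypeR R)) :
  (forall i, measurable (A i)) ->
  lebesgue_tuple n [set t | forall i, A i (tnth t i)] =
    \prod_(i < n) lebesgue_measure (A i).
Proof.
elim: n A => [|n IHn] A mA.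
  by rewrite big_ord0 /= diracE mem_set// => -[].
rewrite big_ord_recl -IHn// -product_measure1E//=.
  rewrite /cons_measure /pushforward; congr (_ \x _)%E.
  apply/seteqP; split=> [[x t]/= xtA|[x t]/= [Ax At] i].
    split; first exact: (xtA ord0).
    by move=> i; have := xtA (lift ord0 i); rewrite tnthS.
  by case: (unliftP ord0 i) => [j ->|->//]; rewrite tnthS.
by have := @measurable_tuple_box n (fun i => A (lift ord0 i)); exact.
Qed.

End lebesgue_tuple.
Arguments lebesgue_tuple {R} n.

Section hyperspherical.
Context (R : realType).

Definition euclidean_ball (n : nat) (rho : R) : set (n.-tuple R) :=
  [set x | Num.sqrt (\sum_(i < n) tnth x i ^+ 2) <= rho].

(* Euler's integral; only meaningful for z > 0. *)
Definition Gamma (z : R) : R :=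
  \int[lebesgue_measure]_(t in `]0, +oo[) (t `^ (z - 1) * expR (- t)).

(* Coordinates and angles are numbered from 0, so for n >= 2 the last
   coordinate, i = n - 1, is the one without a cosine factor. *)
Definition hyperspherical (n : nat) (phi : n.-1.-tuple R) (i : 'I_n) : R :=
  (\prod_(k < i) sin phi`_k) * (if (i.+1 < n)%N then cos phi`_i else 1).

Definition angle_box (n : nat) : set (n.-1.-tuple R) :=
  [set phi | forall k, tnth phi k \in `[0, pi / 2]].
Arguments angle_box n : clear implicits.

Definition Inn (n : nat) : R :=
  \int[lebesgue_tuple n.-1]_(phi in angle_box n)
    (\sum_(i < n) hyperspherical phi i) ^+ n.

Definition avg_vol (n : nat) (rho : R) : R :=
  rho ^+ n * 2 ^+ n / (n`!%:R * (pi / 2) ^+ n.-1) * Inn n.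

End hyperspherical.
Arguments euclidean_ball {R} n rho.
Arguments angle_box {R} n.
Arguments Inn {R} n.

(* Main.v *)
Require Import Defs.
From HB Require Import structures.
From mathcomp Require Import all_boot all_order all_algebra.
From mathcomp Require Import all_classical all_reals all_analysis.
From mathcomp Require Import measurable_realfun ring lra.

Set Implicit Arguments.
Unset Strict Implicit.
Unset Printing Implicit Defensive.

Import Order.TTheory GRing.Theory Num.Theory.
Import numFieldNormedType.Exports.

Local Open Scope classical_set_scope.
Local Open Scope ring_scope.

(* Let S_k be the coordinate sum of a point of the unit sphere with k angles, so that S_(k+1) = cos x + sin x S_k with x a fresh uniform angle. Since cos x + s sin x = sqrt (1 + s^2) cos (x - atan s), the m-th power, for large m, is negligible unless x is within a small delta of atan s; averaging over x therefore gains an arbitrarily small factor over sqrt (1 + s^2)^m. With K = c sqrt m, the latter is at most exp (1 / (2 c^2)) (K^m + s^m), so for m large E (S_(k+1)^m) <= (K^m + E (S_k^m)) / 2 and, by induction, E (S_k^m) <= K^m for every k. Thus Inn n / (pi / 2)^(n-1) <= (c sqrt n)^n for every c > 0 and n large, and crude bounds on n!, Gamma and the volume of the ball suffice. *)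

(** * Pointwise estimates for one angle *)

(** With [a = atan s], one has [s = tan a] and [cos a = 1 / sqrt (1 + s^2)], so this is the
    subtraction formula for [cos (x - a)] divided by [cos a]. *)
Lemma cosD_sinM_phase (R : realType) (s x : R) :
  cos x + sin x * s = Num.sqrt (1 + s ^+ 2) * cos (x - atan s).
Proof.
have := cos_atan s; have := atanK s; rewrite /tan; set a := atan s => as_ ca.
have r0 : 0 < Num.sqrt (1 + s ^+ 2) by rewrite sqrtr_gt0 ltr_wpDr ?sqr_ge0.
have ca0 : cos a != 0 by rewrite ca invr_neq0// gt_eqF.
have -> : cos (x - a) = cos a * (cos x + sin x * s).
  rewrite cosB -[in RHS]as_; field.
  exact: ca0.
by rewrite ca mulrA mulfV ?mul1r// gt_eqF.
Qed.

Lemma cosD_sinM_ge0 (R : realType) (s x : R) :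
  0 <= x <= pi / 2 -> 0 <= s -> 0 <= cos x + sin x * s.
Proof.
move=> /andP[x0 x1] s0; have pi0 := pi_gt0 R.
rewrite addr_ge0 ?mulr_ge0//; first by apply: cos_ge0_pihalf; rewrite x1 andbT; lra.
by apply: sin_ge0_pi; rewrite x0/=; lra.
Qed.

(** After squaring, [1 + s^2 <= s^2 (1 + 1 / K^2)] because [s >= K], and [1 + u <= exp u] with
    [u = 1 / K^2]. *)
Lemma sqrt_oneDsqr_le (R : realType) (K s : R) : 0 < K -> K <= s ->
  Num.sqrt (1 + s ^+ 2) <= s * expR ((2 * K ^+ 2)^-1).
Proof.
move=> K0 Ks; have s0 : 0 < s by exact: lt_le_trans Ks.
have -> : s * expR ((2 * K ^+ 2)^-1) = Num.sqrt ((s * expR ((2 * K ^+ 2)^-1)) ^+ 2).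
  by rewrite sqrtr_sqr ger0_norm// mulr_ge0 ?expR_ge0 ?ltW.
rewrite ler_sqrt ?sqr_ge0// exprMn -expRM_natl.
have -> : 2%:R * (2 * K ^+ 2)^-1 = (K ^+ 2)^-1.
  by field; rewrite gt_eqF.
apply: (@le_trans _ _ (s ^+ 2 * (1 + (K ^+ 2)^-1))).
  rewrite mulrDr mulr1 addrC lerD2l ler_pdivlMr ?exprn_gt0// mul1r.
  by rewrite ler_pXn2r ?nnegrE// ltW.
by rewrite ler_wpM2l ?sqr_ge0// expR_ge1Dx.
Qed.

(** The larger of [s] and [K = c sqrt m] carries the estimate. At this scale of [K] the factor lost
    in the [m]-th power, [exp (m / (2 K^2))], no longer depends on [m]. *)
Lemma sqrt_oneDsqr_expr_le (R : realType) (c s : R) (m : nat) :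
  0 < c -> 0 <= s -> (0 < m)%N ->
  Num.sqrt (1 + s ^+ 2) ^+ m <=
    expR ((2 * c ^+ 2)^-1) * ((c * Num.sqrt m%:R) ^+ m + s ^+ m).
Proof.
move=> c0 s0 m0; set K := c * _.
have K0 : 0 < K by rewrite mulr_gt0// sqrtr_gt0 ltr0n.
have E : expR ((2 * K ^+ 2)^-1) ^+ m = expR ((2 * c ^+ 2)^-1).
  rewrite -expRM_natl; congr expR.
  rewrite exprMn sqr_sqrtr ?ler0n// -mulr_natr; field.
  by rewrite (gt_eqF c0) pnatr_eq0 -lt0n m0.
clearbody K; have [Ks|/ltW sK] := leP K s.
  apply: (@le_trans _ _ ((s * expR ((2 * K ^+ 2)^-1)) ^+ m)).
    by rewrite lerXn2r ?nnegrE ?sqrtr_ge0 ?mulr_ge0 ?expR_ge0// sqrt_oneDsqr_le.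
  rewrite exprMn E mulrC ler_wpM2l ?expR_ge0//.
  by rewrite lerDr exprn_ge0// ltW.
(* For [s <= K], monotonicity reduces to the boundary case [s = K]. *)
apply: (@le_trans _ _ ((K * expR ((2 * K ^+ 2)^-1)) ^+ m)).
  rewrite lerXn2r ?nnegrE ?sqrtr_ge0 ?mulr_ge0 ?expR_ge0 ?(ltW K0)//.
  apply: le_trans _ (sqrt_oneDsqr_le K0 (lexx K)).
  by rewrite ler_sqrt ?lerD2l ?lerXn2r ?nnegrE ?(ltW K0)// addr_ge0 ?sqr_ge0.
rewrite exprMn E mulrC ler_wpM2l ?expR_ge0//.
by rewrite lerDl exprn_ge0.
Qed.

(** The indicator pays for [|t| <= delta], where [cos t <= 1]; further out, [cos] decreases in
    [|t|]. *)
Lemma cos_expr_le (R : realType) (delta t : R) (m : nat) :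
  0 <= delta <= pi / 2 -> `|t| <= pi / 2 ->
  cos t ^+ m <= \1_(`[- delta, delta]%classic : set R) t + cos delta ^+ m.
Proof.
move=> /andP[d0 dpi] tpi; have pi0 := pi_gt0 R.
have cd0 : 0 <= cos delta by apply: cos_ge0_pihalf; rewrite dpi andbT; lra.
have ct0 : 0 <= cos t by apply: cos_ge0_pihalf; rewrite -ler_norml.
rewrite indicE; case: (boolP (_ \in _)) => [_|].
  by rewrite -[leLHS]addr0 lerD ?exprn_ge0// exprn_ile1// cos_le1.
rewrite notin_setE/= in_itv/= => /negP; rewrite -ler_norml -ltNge => dt.
rewrite add0r lerXn2r ?nnegrE// -(cos_norm t) leNgt.
by rewrite ltr_cos ?in_itv/= ?normr_ge0 ?d0/= -?leNgt ?(ltW dt)//; lra.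
Qed.

Lemma cosD_sinM_expr_le (R : realType) (delta s x : R) (m : nat) :
  0 < delta <= pi / 2 -> 0 <= s -> 0 <= x <= pi / 2 ->
  (cos x + sin x * s) ^+ m <= Num.sqrt (1 + s ^+ 2) ^+ m *
    (\1_(`[atan s - delta, atan s + delta]%classic : set R) x + cos delta ^+ m).
Proof.
move=> /andP[d0 dpi] s0 /andP[x0 x1]; have pi0 := pi_gt0 R.
have a0 : 0 <= atan s by rewrite -(atan0 R) le_atan.
have api : atan s < pi / 2 by exact: atan_ltpi2.
rewrite cosD_sinM_phase exprMn ler_wpM2l ?exprn_ge0 ?sqrtr_ge0//.
have -> : \1_(`[atan s - delta, atan s + delta]%classic : set R) x =
    \1_(`[- delta, delta]%classic : set R) (x - atan s) :> R.
  by rewrite !indicE; congr (_ %:R); congr nat_of_bool; apply/idP/idP;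
    rewrite !inE/= !in_itv/= => /andP[? ?]; apply/andP; split; lra.
apply: cos_expr_le; first by rewrite (ltW d0).
by rewrite ler_norml; apply/andP; split; lra.
Qed.

(** * Integration over one angle *)

Lemma measurable_cosD_sinM (R : realType) (s : R) :
  measurable_fun [set: R] (fun x : R => cos x + sin x * s).
Proof.
apply: measurable_funD; first by apply: continuous_measurable_fun; exact: continuous_cos.
apply: measurable_funM => //.
by apply: continuous_measurable_fun; exact: continuous_sin.
Qed.

(** The window around [atan s] has length [2 delta], which bounds its part inside [[0, pi / 2]]; the
    other term is constant on an interval of length [pi / 2]. *)
Lemma integral_cosD_sinM_le (R : realType) (delta s : R) (m : nat) :
  0 < delta <= pi / 2 -> 0 <= s ->
  (\int[lebesgue_measure]_(x in `[0%R, (pi / 2)%R]) ((cos x + sin x * s) ^+ m)%:E <=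
   (Num.sqrt (1 + s ^+ 2) ^+ m * (2 * delta + pi / 2 * cos delta ^+ m))%:E)%E.
Proof.
move=> /andP[d0 dpi] s0; have pi0 := pi_gt0 R.
set r := Num.sqrt _; set a := atan s.
have cd0 : 0 <= cos delta by apply: cos_ge0_pihalf; rewrite dpi andbT; lra.
pose A : set R := `[a - delta, a + delta]%classic.
pose D : set R := `[0, pi / 2]%classic.
have mA : measurable (A : set (measurableTypeR R)) by exact: measurable_itv.
have mD : measurable (D : set (measurableTypeR R)) by exact: measurable_itv.
pose g (x : R) := r ^+ m * (\1_A x + cos delta ^+ m).
have g0 x : 0 <= g x.
  by rewrite mulr_ge0 ?exprn_ge0 ?sqrtr_ge0// addr_ge0 ?exprn_ge0// indicE ler0n.
have mI : measurable_fun D (EFin \o (\1_A : R -> R)).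
  by apply/measurable_EFinP; apply: measurable_indic.
apply: (@le_trans _ _ (\int[lebesgue_measure]_(x in D) (g x)%:E)%E).
  apply: ge0_le_integral => //.
  - by move=> x; rewrite /D/= in_itv/= => xD; rewrite lee_fin exprn_ge0// cosD_sinM_ge0.
  - apply/measurable_EFinP; apply: measurable_funX; apply: measurable_funTS.
    exact: measurable_cosD_sinM.
  - apply/measurable_EFinP; apply: measurable_funM => //.
    by apply: measurable_funD => //; apply/measurable_EFinP.
  - move=> x; rewrite /D/= in_itv/= => xD; rewrite lee_fin.
    by apply: cosD_sinM_expr_le; rewrite ?d0.
have -> : (\int[lebesgue_measure]_(x in D) (g x)%:E = \int[lebesgue_measure]_(x in D)
    ((r ^+ m)%:E * ((\1_A x)%:E + (cos delta ^+ m)%:E)))%E by [].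
rewrite ge0_integralZl_EFin//; last 3 first.
- by move=> x _; rewrite -EFinD lee_fin addr_ge0 ?exprn_ge0// indicE ler0n.
- by apply: emeasurable_funD.
- by rewrite exprn_ge0 ?sqrtr_ge0.
rewrite EFinM lee_wpmul2l ?lee_fin ?exprn_ge0 ?sqrtr_ge0//.
rewrite ge0_integralD//; last first.
  by move=> x _; rewrite lee_fin exprn_ge0.
rewrite EFinD leeD//.
  rewrite integral_indic//.
  apply: (@le_trans _ _ (lebesgue_measure A)).
    by apply: le_measure; rewrite ?inE//; exact: measurableI.
  rewrite /A lebesgue_measure_itv/= lte_fin ifT; last lra.
  by rewrite -EFinB lee_fin; lra.
apply: (@le_trans _ _ ((cos delta ^+ m)%:E * lebesgue_measure D)%E).
  by rewrite (_ : (fun _ => _) = cst (cos delta ^+ m)%:E)// integral_cst.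
rewrite /D lebesgue_measure_itv/= lte_fin divr_gt0// -EFinB -EFinM lee_fin.
by rewrite subr0 mulrC.
Qed.

(** Since [pi / 4] is half the length of the interval, averaging over one angle gives at most the
    mean of [(c sqrt m)^m] and [s^m]. The threshold on [m] is uniform in [s], which lets the
    estimate be iterated over any number of angles with [m] fixed. *)
Lemma integral_cosD_sinM_contract (R : realType) (c : R) : 0 < c ->
  \forall m \near \oo, forall s : R, 0 <= s ->
  (\int[lebesgue_measure]_(x in `[0%R, (pi / 2)%R]) ((cos x + sin x * s) ^+ m)%:E <=
   (pi / 4 * ((c * Num.sqrt m%:R) ^+ m + s ^+ m))%:E)%E.
Proof.
move=> c0; have pi0 := pi_gt0 R.
set E := expR ((2 * c ^+ 2)^-1).
have E0 : 0 < E by exact: expR_gt0.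
have E1 : 1 < E by rewrite expR_gt1 invr_gt0 mulr_gt0// exprn_gt0.
(* This makes [E * (2 * delta) = pi / 8], half of the available [pi / 4]. *)
pose delta : R := pi / 16 / E.
have Ed : E * delta = pi / 16 by rewrite mulrC divfK// gt_eqF.
have d0 : 0 < delta by rewrite divr_gt0// divr_gt0.
have dpi : delta < pi / 2 by nra.
have cd0 : 0 <= cos delta by apply: cos_ge0_pihalf; apply/andP; split; lra.
have cd1 : cos delta < 1.
  by rewrite -(cos0 R) ltr_cos ?in_itv//=; apply/andP; split; lra.
have : (GRing.exp (cos delta) : R^nat) @ \oo --> 0 by apply: cvg_expr; rewrite ger0_norm.
(* The other half: [cos delta ^+ m < 1 / (4 E)] gives [E * (pi / 2) * cos delta ^+ m <= pi / 8]. *)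
move=> /cvgr_lt/(_ (4 * E)^-1).
rewrite invr_gt0 mulr_gt0// => /(_ isT) H.
near=> m; move=> s s0.
have m0 : (0 < m)%N by near: m; exact: nbhs_infty_gt.
have cm : E * cos delta ^+ m <= 4^-1.
  rewrite -ler_pdivlMl// -invfM mulrC ltW//.
  by near: m.
apply: (le_trans (@integral_cosD_sinM_le _ delta s m _ s0)).
  by rewrite d0 ltW.
rewrite lee_fin; set F := _ + s ^+ m.
have F0 : 0 <= F by rewrite addr_ge0 ?exprn_ge0// mulr_ge0 ?sqrtr_ge0 ?ltW.
apply: (@le_trans _ _ (E * F * (2 * delta + pi / 2 * cos delta ^+ m))).
  rewrite ler_wpM2r ?sqrt_oneDsqr_expr_le//.
  by have := exprn_ge0 m cd0; nra.
rewrite -mulrA mulrCA [leRHS]mulrC; apply: ler_wpM2l => //.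
by nra.
Unshelve. all: by end_near.
Qed.

(** * Iteration over the angles *)

(** Tonelli in the form used by the induction: the first variable, the new angle, is integrated out
    first, with the others fixed. *)
Lemma ge0_integral_setX_le d1 d2 (T1 : measurableType d1) (T2 : measurableType d2)
    (R : realType) (m1 : {sigma_finite_measure set T1 -> \bar R})
    (m2 : {sigma_finite_measure set T2 -> \bar R}) (A : set T1) (B : set T2)
    (f : T1 * T2 -> \bar R) (h : T2 -> \bar R) :
  measurable A -> measurable B -> measurable_fun (A `*` B) f ->
  (forall z, (A `*` B) z -> (0 <= f z)%E) ->
  measurable_fun B h ->
  (forall y, B y -> (\int[m1]_(x in A) f (x, y) <= h y)%E) ->
  (\int[m1 \x m2]_(z in A `*` B) f z <= \int[m2]_(y in B) h y)%E.
Proof.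
move=> mA mB mf f0 mh fh.
(* Tonelli is applied on the whole product space, so both integrands are extended by zero. *)
rewrite integral_mkcond [leRHS]integral_mkcond.
have mAB : measurable (A `*` B) by apply: measurableX.
have mfAB : measurable_fun setT (f \_ (A `*` B)).
  have [H _] := measurable_restrictT f mAB.
  exact: H mf.
have fAB0 z : (0 <= (f \_ (A `*` B)) z)%E by apply: erestrict_ge0.
rewrite fubini_tonelli2//; apply: ge0_le_integral => //.
- by move=> y _; apply: integral_ge0.
- exact: measurable_fun_fubini_tonelli_G.
- exact/(measurable_restrictT _ mB).1.
move=> y _; rewrite /fubini_G.
have [By|By] := boolP (y \in B); last first.
  rewrite integral0_eq.
    by rewrite patchN.
  move=> x _; rewrite patchN//; apply/negP; rewrite inE => -[_ /=].
  by move/mem_set; exact/negP.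
rewrite patchT//; apply: le_trans (fh y _); last by rewrite inE in By.
rewrite [leRHS]integral_mkcond le_eqVlt; apply/predU1P; left.
apply: eq_integral => x _; rewrite !patchE; congr (if _ then _ else _).
rewrite inE in By; apply/idP/idP; rewrite !inE/=; first by case.
by split.
Qed.

(** Every coordinate after the first contains the sine of the first angle; factoring it out leaves
    the coordinate sum for the remaining angles. The base value 1 is the single coordinate in
    dimension 1. Plain sequences make the recursion free of length indices. *)
Definition coord_sum (R : realType) (phi : seq R) : R :=
  foldr (fun x s => cos x + sin x * s) 1 phi.

Lemma coord_sumE (R : realType) (phi : seq R) :
  \sum_(i < (size phi).+1)
    (\prod_(k < i) sin phi`_k) * (if (i < size phi)%N then cos phi`_i else 1) =
  coord_sum phi.
Proof.
elim: phi => [|x phi IH] /=; first by rewrite big_ord1 big_ord0 mul1r.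
rewrite big_ord_recl big_ord0 mul1r/= -IH mulr_sumr; congr (_ + _).
by apply: eq_bigr => i _; rewrite big_ord_recl/= mulrA.
Qed.

Lemma sum_hyperspherical (R : realType) (k : nat) (phi : k.-tuple R) :
  \sum_(i < k.+1) @hyperspherical R k.+1 phi i = coord_sum phi.
Proof. by have := coord_sumE phi; rewrite size_tuple. Qed.

Lemma coord_sum_ge0 (R : realType) (k : nat) (phi : k.-tuple R) :
  angle_box k.+1 phi -> 0 <= coord_sum phi.
Proof.
move=> /= phib; have {phib} : all (mem `[0, pi / 2]) phi.
  by apply/all_tnthP => i; exact: phib.
elim: (phi : seq R) => //= x s IH /andP[]; rewrite in_itv/= => xb /IH.
exact: cosD_sinM_ge0.
Qed.

Lemma measurable_coord_sum (R : realType) (k : nat) :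
  measurable_fun [set: k.-tuple (measurableTypeR R)]
    (fun phi : k.-tuple (measurableTypeR R) => coord_sum phi : measurableTypeR R).
Proof.
elim: k => [|k IH].
  apply: (eq_measurable_fun (cst (1 : measurableTypeR R))) => // phi _.
  by rewrite tuple0.
apply: (eq_measurable_fun (fun phi : k.+1.-tuple (measurableTypeR R) =>
  cos (thead phi : R) + sin (thead phi : R) * coord_sum [tuple of behead phi])).
  by move=> phi _; rewrite [in RHS](tuple_eta phi).
have mth : measurable_fun [set: k.+1.-tuple (measurableTypeR R)] (@thead k (measurableTypeR R)).
  exact: measurable_tnth.
apply: measurable_funD.
  apply: (measurableT_comp _ mth).
  by apply: continuous_measurable_fun; exact: continuous_cos.
apply: measurable_funM.
  apply: (measurableT_comp _ mth).
  by apply: continuous_measurable_fun; exact: continuous_sin.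
apply: (measurableT_comp IH).
exact: measurable_behead.
Qed.

Lemma measurable_angle_box (R : realType) (k : nat) :
  measurable (angle_box k.+1 : set (k.-tuple (measurableTypeR R))).
Proof.
exact: (@measurable_tuple_box R k (fun=> [set` `[0%R, (pi / 2)%R]])).
Qed.

Lemma lebesgue_angle_box (R : realType) (k : nat) :
  lebesgue_tuple k (angle_box k.+1) = ((pi / 2 : R) ^+ k)%:E.
Proof.
apply: etrans (@lebesgue_tuple_box R k (fun=> [set` `[0%R, (pi / 2)%R]]) _) _ => //.
under eq_bigr do rewrite lebesgue_measure_itv/= lte_fin divr_gt0 ?pi_gt0// sube0.
by rewrite prodEFin prodr_const card_ord.
Qed.

(** The bound [C] on the mean is stable: if it holds for [k] angles, then one more angle yields at
    most [(C + C) / 2 = C]. The exponent [m] stays fixed while [k] varies. *)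
Lemma integral_coord_sum_le (R : realType) (C : R) (m : nat) : 1 <= C ->
  (forall s : R, 0 <= s ->
    (\int[lebesgue_measure]_(x in `[0%R, (pi / 2)%R]) ((cos x + sin x * s) ^+ m)%:E <=
    (pi / 4 * (C + s ^+ m))%:E)%E) ->
  forall k, (\int[lebesgue_tuple k]_(phi in angle_box k.+1) (coord_sum phi ^+ m)%:E <=
    ((pi / 2) ^+ k * C)%:E)%E.
Proof.
move=> C1 HC; have pi0 := pi_gt0 R.
have mX k D : measurable_fun D (fun phi : k.-tuple (measurableTypeR R) =>
    (coord_sum phi ^+ m)%:E).
  apply/measurable_EFinP; apply: measurable_funX; apply: measurable_funTS.
  exact: measurable_coord_sum.
elim=> [|k IH].
  (* With no angle the measure is a Dirac mass and the coordinate sum is 1, whence the hypothesis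
     [1 <= C]. *)
  rewrite integral_dirac; [|exact: measurable_angle_box|exact: mX].
  rewrite diracE mem_set/=; last by case.
  by rewrite mul1e /coord_sum/= expr1n expr0 mul1r lee_fin.
have E : @Defs.cons_tuple _ (measurableTypeR R) k @^-1` angle_box k.+2 =
    [set` `[0%R, (pi / 2)%R]] `*` angle_box k.+1.
  apply/seteqP; split=> [[x t]/= xt|[x t]/= [x0 t0] i].
    by split=> [|i]; [exact: (xt ord0)|have := xt (lift ord0 i); rewrite tnthS].
  by case: (unliftP ord0 i) => [j ->|->//]; rewrite tnthS.
(* The integral is pulled back along [cons_tuple] to the product of the interval of the head angle
   and the box of the others. *)
rewrite /= /cons_measure ge0_integral_pushforward; last 4 first.
- exact: measurable_cons_tuple.
- exact: measurable_angle_box.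
- exact: mX.
- by move=> phi; rewrite inE => /coord_sum_ge0 ?; rewrite lee_fin exprn_ge0.
rewrite E.
have mC : measurable_fun (angle_box k.+1 : set (k.-tuple (measurableTypeR R)))
    (fun phi => (C%:E + (coord_sum phi ^+ m)%:E)%E).
  by apply: emeasurable_funD; [exact: measurable_cst|exact: mX].
have C0 : 0 <= C by exact: le_trans C1.
have S0 (phi : k.-tuple R) : angle_box k.+1 phi -> (0 <= (coord_sum phi ^+ m)%:E)%E.
  by move=> /coord_sum_ge0 ?; rewrite lee_fin exprn_ge0.
apply: (@le_trans _ _ (\int[lebesgue_tuple k]_(phi in angle_box k.+1)
    ((pi / 4)%:E * (C%:E + (coord_sum phi ^+ m)%:E))%E)%E).
  apply: ge0_integral_setX_le => //.
  - exact: measurable_angle_box.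
  - apply: measurable_funTS; apply: (measurableT_comp (mX k.+1 setT)).
    exact: measurable_cons_tuple.
  - move=> [x t] [/= xb /coord_sum_ge0 t0]; rewrite lee_fin exprn_ge0//.
    by apply: cosD_sinM_ge0 => //; rewrite in_itv/= in xb.
  - exact: measurable_funeM.
  - by move=> t /coord_sum_ge0 t0; exact: HC.
have mb := @measurable_angle_box R k.
rewrite ge0_integralZl_EFin; last 4 first.
- exact: mb.
- by move=> t /S0 ?; rewrite adde_ge0// lee_fin.
- exact: mC.
- by rewrite divr_ge0// ltW.
rewrite ge0_integralD; last 5 first.
- exact: mb.
- by move=> t _; rewrite lee_fin.
- exact: measurable_cst.
- exact: S0.
- exact: mX.
apply: (@le_trans _ _ ((pi / 4 * (C * (pi / 2) ^+ k + (pi / 2) ^+ k * C))%:E)).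
  rewrite [leRHS]EFinM; apply: lee_wpmul2l; first by rewrite lee_fin divr_ge0 ?ltW.
  rewrite [leRHS]EFinD; apply: leeD => //.
  by rewrite (_ : (fun _ => _) = cst C%:E)// integral_cst// [leRHS]EFinM -lebesgue_angle_box.
rewrite lee_fin le_eqVlt; apply/predU1P; left.
by rewrite exprS; field.
Qed.

(** There are [n - 1] angles but the exponent is [n]. As [Inn] is the [fine] part of an extended
    integral, the upper bound also supplies the finiteness needed to read it as a real
    inequality. *)
Lemma Inn_le_of_contract (R : realType) (C : R) (n : nat) : (0 < n)%N -> 1 <= C ->
  (forall s : R, 0 <= s ->
    (\int[lebesgue_measure]_(x in `[0%R, (pi / 2)%R]) ((cos x + sin x * s) ^+ n)%:E <=
    (pi / 4 * (C + s ^+ n))%:E)%E) ->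
  0 <= Inn n :> R /\ Inn n <= (pi / 2) ^+ n.-1 * C.
Proof.
case: n => // k _ C1 /(integral_coord_sum_le C1)/(_ k); rewrite /Inn /Rintegral/= => H.
under eq_integral do rewrite sum_hyperspherical.
have I0 : (0 <= \int[@lebesgue_tuple R k]_(phi in angle_box k.+1)
    (coord_sum phi ^+ k.+1)%:E)%E.
  by apply: integral_ge0 => phi /coord_sum_ge0 ?; rewrite lee_fin exprn_ge0.
split; first exact: fine_ge0.
rewrite -lee_fin fineK// ge0_fin_numE//.
by apply: le_lt_trans H _; rewrite ltry.
Qed.

Lemma Inn_le (R : realType) (c : R) : 0 < c ->
  \forall n \near \oo,
    0 <= Inn n :> R /\ Inn n <= (pi / 2) ^+ n.-1 * (c * Num.sqrt n%:R) ^+ n.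
Proof.
move=> c0; have pi0 := pi_gt0 R.
near=> n.
have n0 : (0 < n)%N by near: n; exact: nbhs_infty_gt.
(* The base case needs [1 <= (c sqrt n)^n], which holds as soon as [n >= c^-2]. *)
have K1 : 1 <= c * Num.sqrt n%:R.
  rewrite -ler_pdivrMl// mulr1.
  apply: (@le_trans _ _ (Num.sqrt (c^-1 ^+ 2))); first by rewrite sqrtr_sqr ler_norm.
  rewrite ler_sqrt ?ler0n//.
  by near: n; exact: nbhs_infty_ger.
apply: Inn_le_of_contract => //; first exact: exprn_ege1.
by near: n; exact: integral_cosD_sinM_contract.
Unshelve. all: by end_near.
Qed.

(** * Bounds on the factorial and on Gamma *)

(** The quotient [n^n / n!] is a single term of the exponential series of [exp n]. *)
Lemma exprnn_le_fact (R : realType) (n : nat) :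
  (n%:R : R) ^+ n <= n`!%:R * expR 1 ^+ n.
Proof.
case: n => [|n]; first by rewrite !expr0 fact0 mulr1.
rewrite -expRM_natl mulr1 mulrC -ler_pdivrMr ?ltr0n ?fact_gt0//.
apply: le_trans (@expR_ge1Dxn R _ n (ler0n _ _)).
by rewrite lerDr.
Qed.

(** Half of the exponential is kept for integrability. What remains is the [n]-th power of
    [sqrt t <= sqrt (n exp (t / n))], that is, of [t / n <= exp (t / n)]. *)
Lemma powR_half_expR_le (R : realType) (n : nat) (t : R) : (0 < n)%N -> 0 <= t ->
  t `^ (n%:R / 2) * expR (- t) <= Num.sqrt n%:R ^+ n * expR (- (t / 2)).
Proof.
move=> n0 t0; have n0' : 0 < n%:R :> R by rewrite ltr0n.
have -> : t `^ (n%:R / 2) = Num.sqrt t ^+ n.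
  by rewrite mulrC powRrM powR12_sqrt// powR_mulrn// sqrtr_ge0.
have -> : expR (- t) = expR (- (t / 2)) * expR (- (t / 2)).
  by rewrite -expRD; congr expR; field.
rewrite mulrA ler_wpM2r ?expR_ge0// expRN ler_pdivrMr ?expR_gt0//.
have -> : expR (t / 2) = expR (t / (2 * n%:R)) ^+ n.
  by rewrite -expRM_natl; congr expR; field; rewrite gt_eqF.
rewrite -exprMn lerXn2r ?nnegrE ?mulr_ge0 ?sqrtr_ge0 ?expR_ge0//.
have -> : expR (t / (2 * n%:R)) = Num.sqrt (expR (t / n%:R)).
  have -> : t / n%:R = 2%:R * (t / (2 * n%:R)) by field; rewrite gt_eqF.
  by rewrite expRM_natl sqrtr_sqr ger0_norm ?expR_ge0.
rewrite -sqrtrM ?ler0n// ler_sqrt; last by rewrite mulr_ge0 ?expR_ge0 ?ler0n.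
rewrite -ler_pdivrMl// mulrC; apply: le_trans (expR_ge1Dx _).
by rewrite lerDr.
Qed.

Lemma Gamma_ge0 (R : realType) (z : R) : 0 <= Gamma z.
Proof.
by apply: Rintegral_ge0 => t _; rewrite mulr_ge0 ?powR_ge0 ?expR_ge0.
Qed.

(** The pointwise bound [sqrt n ^ n * exp (- t / 2)] is [C] times the exponential density of rate
    [1 / 2], whose total mass is 1; the factor 2 in [C] is the inverse rate. *)
Lemma Gamma_half_le (R : realType) (n : nat) : (0 < n)%N ->
  Gamma (n%:R / 2 + 1 : R) <= 2 * Num.sqrt n%:R ^+ n.
Proof.
move=> n0; rewrite /Gamma /Rintegral addrK.
set C := 2 * _; have C0 : 0 <= C by rewrite mulr_ge0// exprn_ge0.
pose D : set R := `]0, +oo[%classic.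
have mD : measurable (D : set (measurableTypeR R)) by exact: measurable_itv.
have h0 : (0 : R) <= 2^-1 by rewrite invr_ge0.
have mf (E : set R) : measurable_fun E (fun t : R => t `^ (n%:R / 2) * expR (- t)).
  apply: measurable_funTS; apply: measurable_funM; first exact: measurable_powR.
  by apply: measurableT_comp => //; exact: measurable_expR.
have mg (E : set R) : measurable_fun E (fun t : R => C * exponential_pdf 2^-1 t).
  by apply: measurable_funTS; apply: measurable_funM => //; exact: measurable_exponential_pdf.
have f0 t : 0 <= t `^ (n%:R / 2) * expR (- t) :> R by rewrite mulr_ge0 ?powR_ge0 ?expR_ge0.
have g0 t : 0 <= C * exponential_pdf 2^-1 t :> R by rewrite mulr_ge0// exponential_pdf_ge0.
(* Bounding the extended integral first also gives the finiteness required to remove [fine]. *)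
have H : (\int[lebesgue_measure]_(t in D) (t `^ (n%:R / 2) * expR (- t))%:E <= C%:E)%E.
  apply: (@le_trans _ _ (\int[lebesgue_measure]_(t in D) (C * exponential_pdf 2^-1 t)%:E)%E).
    apply: ge0_le_integral => //.
    - by move=> t _; rewrite lee_fin.
    - apply/measurable_EFinP; exact: mf.
    - apply/measurable_EFinP; exact: mg.
    move=> t; rewrite /D/= in_itv/= andbT => /ltW t0; rewrite lee_fin exponential_pdfE//.
    apply: le_trans (powR_half_expR_le n0 t0) _.
    have -> : - 2^-1 * t = - (t / 2) by field.
    by rewrite /C mulrACA mulfV ?pnatr_eq0// mul1r.
  apply: (@le_trans _ _ (\int[lebesgue_measure]_t (C * exponential_pdf 2^-1 t)%:E)%E).
    apply: ge0_subset_integral => //; first by apply/measurable_EFinP; exact: mg.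
    by move=> t _; rewrite lee_fin.
  under eq_integral do rewrite EFinM.
  rewrite ge0_integralZl_EFin//.
  - by rewrite integral_exponential_pdf ?invr_gt0// mule1.
  - by move=> t _; rewrite lee_fin exponential_pdf_ge0.
  - by apply/measurable_EFinP; exact: measurable_exponential_pdf.
rewrite -lee_fin fineK// ge0_fin_numE.
  by apply: le_lt_trans H _; rewrite ltry.
by apply: integral_ge0 => t _; rewrite lee_fin.
Qed.

(** * Measurability and volume of the Euclidean ball *)

Lemma measurable_euclidean_ball (R : realType) (n : nat) (rho : R) :
  measurable (euclidean_ball n rho : set (n.-tuple (measurableTypeR R))).
Proof.
(* A negative radius gives the empty set; otherwise the defining inequality can be squared. *)
have [rho0|rho0] := leP 0 rho; last first.
  rewrite (_ : euclidean_ball _ _ = set0)//; apply/seteqP; split=> // x.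
  by rewrite /euclidean_ball/= leNgt (lt_le_trans rho0)// sqrtr_ge0.
have m2 : measurable_fun [set: n.-tuple (measurableTypeR R)]
    (fun x : n.-tuple (measurableTypeR R) => \sum_(i < n) (tnth x i : R) ^+ 2).
  by apply: measurable_sum => i; apply: measurable_funX; exact: measurable_tnth.
rewrite (_ : euclidean_ball _ _ = [set: n.-tuple (measurableTypeR R)] `&`
    (fun x : n.-tuple (measurableTypeR R) => \sum_(i < n) (tnth x i : R) ^+ 2) @^-1`
      [set` `]-oo, (rho ^+ 2)%R]]).
  by apply: m2 => //; exact: measurable_itv.
have sqrt_le y : (Num.sqrt y <= rho) = (y <= rho ^+ 2).
  by rewrite -{1}(ger0_norm rho0) -sqrtr_sqr ler_sqrt// sqr_ge0.
by rewrite setTI; apply/seteqP; split=> x; rewrite /euclidean_ball/= in_itv/= sqrt_le.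
Qed.

(* The left-hand side is the volume of the inscribed cube. *)
Lemma lebesgue_euclidean_ball_ge (R : realType) (n : nat) (rho : R) :
  (0 < n)%N -> 0 < rho ->
  (((2 * rho / Num.sqrt n%:R) ^+ n)%:E <= lebesgue_tuple n (euclidean_ball n rho))%E.
Proof.
move=> n0 rho0; have s0 : 0 < Num.sqrt n%:R :> R by rewrite sqrtr_gt0 ltr0n.
set l := rho / Num.sqrt n%:R; have l0 : 0 < l by rewrite divr_gt0.
pose A (i : 'I_n) : set (measurableTypeR R) := [set` `[(- l)%R, l]].
have mA i : measurable (A i) by exact: measurable_itv.
have -> : ((2 * rho / Num.sqrt n%:R) ^+ n)%:E =
    lebesgue_tuple n [set t | forall i, A i (tnth t i)].
  rewrite lebesgue_tuple_box//.
  under eq_bigr do rewrite /A lebesgue_measure_itv/= lte_fin gtrN// -EFinB.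
  rewrite prodEFin prodr_const card_ord; congr ((_ ^+ _)%:E).
  by rewrite /l; field; rewrite gt_eqF.
apply: le_measure; rewrite ?inE.
- exact: measurable_tuple_box.
- exact: measurable_euclidean_ball.
move=> x Ax /=.
apply: (@le_trans _ _ (Num.sqrt (rho ^+ 2))); last by rewrite sqrtr_sqr gtr0_norm.
rewrite ler_sqrt ?sqr_ge0//.
have -> : rho ^+ 2 = \sum_(i < n) l ^+ 2.
  rewrite sumr_const card_ord -mulr_natl /l exprMn exprVn sqr_sqrtr ?ler0n//.
  by rewrite mulrCA mulfV ?mulr1// pnatr_eq0 -lt0n.
apply: ler_sum => i _; have := Ax i; rewrite /A/= in_itv/= -ler_norml => xl.
by rewrite -[leLHS]real_normK ?num_real// lerXn2r ?nnegrE// ltW.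
Qed.

(** * Assembling the estimates *)

(** One factor [sqrt n ^ n] comes from the bound on [Inn], the other from Gamma or from the
    inscribed cube; together they make [n^n], which [n!] absorbs up to [e^n]. *)
Lemma exprn_sqrt_le_fact (R : realType) (n : nat) :
  ((4 * expR 1)^-1 * Num.sqrt n%:R) ^+ n * Num.sqrt n%:R ^+ n <= 4^-1 ^+ n * n`!%:R :> R.
Proof.
rewrite -exprMn -mulrA -expr2 sqr_sqrtr ?ler0n// exprMn.
apply: le_trans (ler_wpM2l _ (exprnn_le_fact R n)) _.
  by rewrite exprn_ge0// invr_ge0 mulr_ge0 ?expR_ge0.
by rewrite mulrCA -exprMn invfM -mulrA mulVf ?gt_eqF ?expR_gt0// mulr1 mulrC.
Qed.

Theorem mainTheorem4 (R : realType) :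
  (Inn n * 2 ^+ n / (n`!%:R * (pi / 2) ^+ n.-1) /
     (pi `^ (n%:R / 2) / Gamma (n%:R / 2 + 1)) @[n --> \oo] --> (0 : R)) /\
  exists n0 : nat, (2 <= n0)%N /\
    forall (n : nat) (rho : R), (n0 <= n)%N -> 0 < rho ->
      ((avg_vol n rho)%:E < lebesgue_tuple n (euclidean_ball n rho))%E.
Proof.
have pi0 := pi_gt0 R; have e0 := expR_gt0 (1 : R).
(* The factor [e] cancels the loss in [n^n <= n! e^n]; the 4 leaves [4^-n], enough to beat [2^n]. *)
set c : R := (4 * expR 1)^-1.
have c0 : 0 < c by rewrite invr_gt0 mulr_gt0.
have HI := Inn_le c0.
split.
  (* The upper bound is [2 * 2^-n]: the leading 2 comes from the Gamma bound, and [2^-n] is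
     [2^n * 4^-n]. *)
  apply: (@squeeze_cvgr _ _ _ _ (fun=> 0) (geometric 2 (2^-1 : R))); last 2 first.
  - exact: cvg_cst.
  - by apply: cvg_geometric; rewrite ger0_norm ?invr_ge0// invf_lt1// ltr1n.
  near=> n.
  have n0 : (0 < n)%N by near: n; exact: nbhs_infty_gt.
  have [I0 I1] : 0 <= Inn n :> R /\
      Inn n <= (pi / 2) ^+ n.-1 * (c * Num.sqrt n%:R) ^+ n by near: n.
  have f0 : 0 < n`!%:R :> R by rewrite ltr0n fact_gt0.
  have p0 : 0 < (pi / 2) ^+ n.-1 :> R by rewrite exprn_gt0// divr_gt0.
  (* The power of [pi] in the denominator is simply bounded below by 1. *)
  have q1 : 1 <= pi `^ (n%:R / 2) :> R.
    rewrite -[leLHS](powRr0 pi); apply: ler_powR; last by rewrite divr_ge0.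
    by apply: le_trans _ (pi_ge2 R); rewrite ler1n.
  have G0 := Gamma_ge0 (n%:R / 2 + 1 : R).
    apply/andP; split.
    apply: divr_ge0; last by rewrite divr_ge0// powR_ge0.
    apply: divr_ge0; last by rewrite ltW// mulr_gt0.
    by rewrite mulr_ge0// exprn_ge0.
  rewrite /geometric/= invf_div mulrA ler_pdivrMr ?(lt_le_trans _ q1)//.
  apply: (@le_trans _ _ (2 * 2^-1 ^+ n)); last by rewrite ler_peMr// mulr_ge0 ?exprn_ge0.
  rewrite mulrAC ler_pdivrMr ?mulr_gt0//.
  apply: (@le_trans _ _ (((pi / 2) ^+ n.-1 * (c * Num.sqrt n%:R) ^+ n) * 2 ^+ n *
      (2 * Num.sqrt n%:R ^+ n))).
    rewrite ler_pM ?mulr_ge0 ?exprn_ge0// ?Gamma_half_le//.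
    by rewrite ler_wpM2r// exprn_ge0.
  have := exprn_sqrt_le_fact R n; rewrite -/c => H.
  rewrite [leLHS](_ : _ = (pi / 2) ^+ n.-1 * 2 * 2 ^+ n *
    ((c * Num.sqrt n%:R) ^+ n * Num.sqrt n%:R ^+ n)); last by ring.
  rewrite [leRHS](_ : _ = (pi / 2) ^+ n.-1 * 2 * 2 ^+ n * (4^-1 ^+ n * n`!%:R)).
    by rewrite ler_wpM2l// mulr_ge0 ?exprn_ge0// mulr_ge0// ltW.
  have -> : 4^-1 = 2^-1 * 2^-1 :> R by field.
  have e2 : 2 ^+ n * 2^-1 ^+ n = 1 :> R by rewrite -exprMn mulfV ?expr1n.
  rewrite [(2^-1 * _) ^+ n]exprMn [RHS](_ : _ = (2 ^+ n * 2^-1 ^+ n) *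
    ((pi / 2) ^+ n.-1 * 2 * 2^-1 ^+ n * n`!%:R)); last by ring.
  by rewrite e2; ring.
have [N _ HN] := HI.
exists (maxn 2 N); split; first exact: leq_maxl.
move=> n rho; rewrite geq_max => /andP[n2 /HN/=[I0 I1]] rho0.
have n0 : (0 < n)%N by exact: ltnW.
(* Against the cube volume [(2 rho / sqrt n)^n], the factors [rho^n] and [2^n] cancel, so the
   threshold is uniform in [rho]. *)
apply: lt_le_trans (lebesgue_euclidean_ball_ge n0 rho0).
have s0 : 0 < Num.sqrt n%:R :> R by rewrite sqrtr_gt0 ltr0n.
have f0 : 0 < n`!%:R :> R by rewrite ltr0n fact_gt0.
have p0 : 0 < (pi / 2) ^+ n.-1 :> R by rewrite exprn_gt0// divr_gt0.
rewrite lte_fin /avg_vol [ltRHS]exprMn exprVn mulrAC ltr_pdivrMr ?mulr_gt0//.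
rewrite [ltRHS]mulrAC ltr_pdivlMr ?exprn_gt0//.
apply: (@le_lt_trans _ _ (rho ^+ n * 2 ^+ n * ((pi / 2) ^+ n.-1 * (c * Num.sqrt n%:R) ^+ n) *
    Num.sqrt n%:R ^+ n)).
  rewrite ler_wpM2r ?exprn_ge0// ler_wpM2l// mulr_ge0// exprn_ge0//.
  exact: ltW.
have := exprn_sqrt_le_fact R n; rewrite -/c => H.
rewrite [ltLHS](_ : _ = (pi / 2) ^+ n.-1 * rho ^+ n * 2 ^+ n *
    ((c * Num.sqrt n%:R) ^+ n * Num.sqrt n%:R ^+ n)); last by ring.
rewrite [ltRHS](_ : _ = (pi / 2) ^+ n.-1 * rho ^+ n * 2 ^+ n * n`!%:R); last first.
  by rewrite exprMn; ring.
rewrite ltr_pM2l; last by rewrite mulr_gt0 ?exprn_gt0// mulr_gt0// exprn_gt0.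
apply: (le_lt_trans H).
(* Strictness comes from [4^-n < 1], valid because [n > 0]. *)
by rewrite gtr_pMl// exprn_ilt1 ?invr_ge0 ?invf_lt1 ?ltr1n -?lt0n.
Unshelve. all: by end_near.
Qed.
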